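(* Let $N\ge 0$ be an integer, let $X$ be a metric space having property (TAP)($N$), and let $\mu$ be a Radon measure on $X$. Then the analytic dimension of $(X,\mu)$ is at most $N$.
   Context: **(TAP)($N$)** (''tower of approximations by $N$-dimensional polyhedra''). A metric space $(X,d_X)$ has this property if there are constants $C$, $\{C_n\}_n$, a sequence $s_n\searrow 0$, $N$-dimensional polyhedral complexes $P_n$ with metrics $d_{P_n}$ (each restricting on each simplex to a metric induced by a norm), and $C$-Lipschitz maps $F_n:X\to P_n$ such that $$\|F_n^*d_{P_n}-d_X\|_\infty\le Cs_n,\qquad F_n^*d_{P_n}\le C_n\,F_{n+1}^*d_{P_{n+1}},$$ where $F^*d(x,y)=d(F(x),F(y))$. The second condition can be reformulated as the existence of $C_n$-Lipschitz maps $\pi_n:P_{n+1}\to P_n$ with $\pi_n\circ F_{n+1}=F_n$. **Derivations.** $\mathrm{Lip}_b(X)$ is the algebra of bounded real-valued Lipschitz functions on $X$ with norm the maximum of the sup norm and the global Lipschitz constant. $f_n\to f$ weak* in $\mathrm{Lip}_b(X)$ if the global Lipschitz constants of the $f_n$ are uniformly bounded and $f_n\to f$ pointwise. A (Weaver) derivation is a weak* continuous bounded linear map $D:\mathrm{Lip}_b(X)\to L^\infty(\mu)$ with $D(fg)=fDg+gDf$. The derivations form an $L^\infty(\mu)$-module $\mathscr{X}(\mu)$. For $U\subset X$ Borel, $\mathscr{X}(\mu\llcorner U)$ is identified with $\chi_U\mathscr{X}(\mu)$. **Analytic dimension.** The analytic dimension of $(X,\mu)$ is the index of $\mathscr{X}(\mu)$,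 i.e. the supremum of the $n\in\mathbb{N}$ for which there is a Borel set $U\subset X$ such that $\mathscr{X}(\mu\llcorner U)$ contains $n$ elements that are linearly independent over $L^\infty(\mu\llcorner U)$ (with $\mu(U)>0$).
   Formalization: The metrics on the polyhedral complexes are also required to be such that compact sets meet at most countably many open simplices (automatic for countable complexes or metrics inducing the usual topology); otherwise [0,1] as a 0-dimensional complex of points is a counterexample. *)

(* Defs.v *)
From HB Require Import structures.
From mathcomp Require Import all_boot all_order all_algebra finmap.
From mathcomp Require Import all_classical all_reals all_analysis.

Set Implicit Arguments.
Unset Strict Implicit.
Unset Printing Implicit Defensive.

Import Order.TTheory GRing.Theory Num.Theory.
Import numFieldNormedType.Exports.

Local Open Scope classical_set_scope.
Local Open Scope ring_scope.

(* Measurable types are pointed in the library, so Borel measures are taken on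
   pointed (that is, nonempty) metric spaces. *)
#[short(type="pmetricType")]
HB.structure Definition PointedMetric (K : numDomainType) :=
  { M of Metric K M & isPointed M }.

Definition is_lipschitz (R : realType) (X Y : metricType R) (L : R)
    (f : X -> Y) : Prop :=
  forall x y, mdist (f x) (f y) <= L * mdist x y.

(** * Simplicial complexes with metrics that are normed on each simplex *)

Record simplicialComplex := SimplicialComplex {
  vertex : choiceType ;
  simplex : set {fset vertex} ;
  simplex_neq0 : ~ simplex fset0 ;
  simplex_face : forall s t : {fset vertex},
    simplex s -> (t `<=` s)%fset -> t != fset0 -> simplex t }.

(* Points of the realization are given by their barycentric coordinates. *)
Definition closed_simplex (R : realType) (V : choiceType) (s : {fset V}) :
    set (V -> R) :=
  [set b | [/\ forall v, 0 <= b v, forall v, v \notin s -> b v = 0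
             & \sum_(v <- s) b v = 1] ].

Definition realization (R : realType) (K : simplicialComplex) :
    set (vertex K -> R) :=
  \bigcup_(s in @simplex K) closed_simplex s.

Arguments realization : clear implicits.

Definition is_dimension (K : simplicialComplex) (N : nat) : Prop :=
  (forall s, @simplex K s -> (#|` s| <= N.+1)%N) /\
  (exists2 s, @simplex K s & #|` s| = N.+1).

Definition is_norm (R : realType) (E : lmodType R) (nu : E -> R) : Prop :=
  [/\ forall u v, nu (u + v) <= nu u + nu v,
      forall a u, nu (a *: u) = `|a| * nu u
    & forall u, nu u = 0 -> u = 0].

(* A metric space identified, through barycentric coordinates, with the
   realization of a simplicial complex, the metric being given on each closed
   simplex by a norm.

   [metric_compat] expresses that the metric is one on the realization as a
   topological space and not merely on its underlying set.  It is automatic when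
   there are countably many simplices, and also whenever every subcomplex is
   closed for the metric (so whenever the metric induces the weak topology or
   the topology of barycentric coordinates).  Without any such requirement
   every metric space would be a complex of dimension 0, its points being the
   simplices. *)
Record metricComplex (R : realType) := MetricComplex {
  space :> metricType R ;
  complex_of : simplicialComplex ;
  bary : space -> vertex complex_of -> R ;
  bary_inj : injective bary ;
  bary_range : range bary = realization R complex_of ;
  metric_norm : forall s : {fset vertex complex_of}, simplex s ->
    exists2 nu : {ffun s -> R} -> R, is_norm nu &
      forall x y : space, closed_simplex s (bary x) ->
        closed_simplex s (bary y) ->
        mdist x y = nu [ffun v : s => bary x (val v) - bary y (val v)] ;
  metric_compat : forall A : set space, compact A ->
    countable [set s : {fset vertex complex_of} | simplex s /\
      (exists2 x, A x & forall v, (v \in s) = (0 < bary x v))] }.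

Definition TAP (R : realType) (N : nat) (X : metricType R) : Prop :=
  exists (C : R) (Cn : nat -> R) (s : nat -> R) (P : nat -> metricComplex R)
         (F : forall n, X -> P n),
    [/\ nonincreasing_seq s /\ s @ \oo --> (0 : R),
        forall n, is_dimension (complex_of (P n)) N,
        forall n, is_lipschitz C (F n),
        forall n x y, `|mdist (F n x) (F n y) - mdist x y| <= C * s n
      & forall n x y,
          mdist (F n x) (F n y) <= Cn n * mdist (F n.+1 x) (F n.+1 y)].

(** * Radon measures *)


Definition borel (R : realType) (X : pmetricType R) :=
  g_sigma_algebraType (@open X).

Definition is_radon (R : realType) (X : pmetricType R)
    (mu : {measure set (borel X) -> \bar R}) : Prop :=
  (forall x : X, exists U : set X, [/\ open U, U x & (mu U < +oo)%E]) /\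
  (forall B : set (borel X), measurable B ->
    mu B = ereal_sup [set mu K | K in [set K : set X | compact K /\ K `<=` B]]).

(** * Derivations *)

Section Derivations.
Variables (R : realType) (X : pmetricType R).

Definition sup_norm (f : X -> R) : R := sup (range (fun x => `|f x|)).

Definition lip_const (f : X -> R) : R :=
  inf [set L : R | 0 <= L /\ is_lipschitz L (f : X -> R^o)].

Definition lipb : set (X -> R) :=
  [set f | bounded_fun f /\ exists L, is_lipschitz L (f : X -> R^o)].

Definition lipb_norm (f : X -> R) : R := Num.max (sup_norm f) (lip_const f).

Definition lipb_weak_cvg (f : nat -> X -> R) (g : X -> R) : Prop :=
  (exists L, forall n, lip_const (f n) <= L) /\
  (forall x, f n x @[n --> \oo] --> g x).

Variable mu : {measure set (borel X) -> \bar R}.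

Definition Linfty : set (borel X -> R) :=
  [set u | u \in Lfun mu +oo%E].

Definition Linfty_weak_cvg (u : nat -> borel X -> R) (v : borel X -> R) :
    Prop :=
  forall g : borel X -> R, mu.-integrable setT (EFin \o g) ->
    (\int[mu]_x (g x * u n x)%:E)%E @[n --> \oo] -->
    (\int[mu]_x (g x * v x)%:E)%E.

(* A map from [lipb] to the space L^oo(mu) is encoded by a choice of
   representatives, all identities being required almost everywhere; the values
   of [D] outside [lipb] are irrelevant. *)
Record is_derivation (D : (X -> R) -> borel X -> R) : Prop := IsDerivation {
  der_Linfty : forall f, lipb f -> Linfty (D f) ;
  der_linear : forall (a : R) f g, lipb f -> lipb g ->
    {ae mu, forall x, D (a *: f + g) x = a * D f x + D g x} ;
  der_bounded : exists M : R, forall f, lipb f ->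
    ('N[mu]_+oo[EFin \o D f] <= (M * lipb_norm f)%:E)%E ;
  der_leibniz : forall f g, lipb f -> lipb g ->
    {ae mu, forall x, D (f * g) x = f x * D g x + g x * D f x} ;
  der_weak_continuous : forall (f : nat -> X -> R) (g : X -> R),
    (forall n, lipb (f n)) -> lipb g -> lipb_weak_cvg f g ->
    Linfty_weak_cvg (fun n => D (f n)) (D g) }.

Definition lin_indep (n : nat) (D : 'I_n -> (X -> R) -> borel X -> R) : Prop :=
  forall lam : 'I_n -> borel X -> R, (forall i, Linfty (lam i)) ->
    (forall f, lipb f ->
      {ae mu, forall x, \sum_(i < n) lam i x * D i f x = 0}) ->
    forall i, {ae mu, forall x, lam i x = 0}.

End Derivations.

Definition has_indep_derivations (R : realType) (X : pmetricType R)
    (mu : {measure set (borel X) -> \bar R}) (n : nat) : Prop :=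
  exists (U : set (borel X)) (mU : measurable U), (0 < mu U)%E /\
    exists D : 'I_n -> (X -> R) -> borel X -> R,
      (forall i, is_derivation (mrestr mu mU) (D i)) /\
      lin_indep (mrestr mu mU) D.

(* 0 is added so that the supremum, taken in {0, 1, ..., +oo}, of the empty set
   is 0 (case of the zero measure). *)
Definition analytic_dimension (R : realType) (X : pmetricType R)
    (mu : {measure set (borel X) -> \bar R}) : \bar R :=
  ereal_sup [set n%:R%:E |
    n in [set n : nat | n = 0%N \/ has_indep_derivations mu n] ].

(* Main.v *)
Require Import Defs.
From mathcomp Require Import all_boot all_order all_algebra finmap.
From mathcomp Require Import all_classical all_reals all_analysis.
From mathcomp Require Import ess_sup_inf measurable_realfun.
From mathcomp Require Import lra.

Set Implicit Arguments.
Unset Strict Implicit.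
Unset Printing Implicit Defensive.

Import Order.TTheory GRing.Theory Num.Theory.
Import numFieldNormedType.Exports.

Local Open Scope classical_set_scope.
Local Open Scope ring_scope.

(** The analytic dimension is bounded by showing that, for [N+1] derivations
    [D_i] and bounded Lipschitz functions [f_j], the determinant of the Jacobian
    matrix [(D_i f_j)] vanishes almost everywhere ([det_jac_TAP]). This suffices:
    from independent derivations one builds, one row and one column at a time,
    nonzero minors of every size, the cofactors of a larger minor serving as
    coefficients of a forbidden linear relation if it were always zero
    ([lin_indep_minor]).

    A determinant is not weak* continuous in all its columns jointly, but it is
    in each column separately: it is the sum of the entries of that column times
    bounded functions independent of it. So if the determinant vanishes for all
    choices of functions in a class [A], it vanishes for all choices of
    functions that are weak* limits of sequences in [A] ([det_jac_closure]).
    This is used twice.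

    The first use reduces from [X] to a polyhedron. A Lipschitz [f] is the
    uniform limit of the functions [inf_y (f y + L * d (F_m y) (F_m x))], which
    are Lipschitz for the pulled back metric of the [m]-th polyhedron, because
    these metrics converge uniformly to that of [X]. In the iterated limits the
    different columns use different levels [m]; the inequalities between the
    metrics of consecutive levels bring them all to the largest one.

    It remains to treat functions that are Lipschitz for the metric pulled back
    by one map [F] to a complex of dimension at most [N]
    ([det_jac_pullback]). A compact set meets the preimages of countably many
    open simplices only, so by inner regularity one simplex may be considered.
    On the preimage of a simplex, the norm makes such functions Lipschitz in [N]
    of the barycentric coordinates, which are Lipschitz there and extend to
    Lipschitz functions on [X] ([simplex_coordinates]). By McShane's formula, written with a countable
    dense set of base points, each of them is there the limit of finite minima
    of sums of functions [|b_j - a|], where the [b_j] are the coordinates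
    ([gradient_approximation]): this is the second use of weak* limits. Finally,
    derivations are local ([der_local]), so such a piecewise function has, at
    almost every point, partial derivatives with respect to the [N] functions
    [b_j] which serve for all derivations at once. Its Jacobian matrix then
    factors through a space of dimension [N], and its determinant is zero
    ([det_jac_gradient]). *)

(** * Bounded functions and separation by integrable ones *)

Section Linfty.
Variables (R : realType) (X : pmetricType R).
Variable mu : {measure set (borel X) -> \bar R}.
Implicit Types u v g : borel X -> R.

Lemma LinftyP u : Linfty mu u <->
  measurable_fun setT u /\ exists M, {ae mu, forall x, `|u x| <= M}.
Proof.
rewrite /Linfty /=.
have -> : (u \in Lfun mu +oo%E) <->
    measurable_fun setT u /\ ('N[mu]_+oo[EFin \o u] < +oo)%E.
  split => [h|[? ?]].
    by split; apply/set_mem; [exact: sub_Lfun_mfun h|exact: sub_Lfun_finLfun h].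
  by rewrite -topredE /=; apply/andP; split; exact: mem_set.
rewrite unlock; split => -[mu_ h]; split => //.
- move: h; case: ifPn => [mu0 h|].
    have [M hM] := @ess_supr_bounded _ _ _ mu (fun x => `|u x|) h.
    by exists M.
  rewrite -leNgt measure_le0 => /eqP muT0 _; exists 0.
  exact: measure0_ae.
- have [M hM] := h; case: ifPn => // _.
  apply: (@le_lt_trans _ _ M%:E); last by rewrite ltry.
  by apply/ess_supP; apply: filterS hM => x; rewrite /= lee_fin.
Qed.

Lemma Linfty_measurable u : Linfty mu u -> measurable_fun setT u.
Proof. by case/LinftyP. Qed.

Lemma Linfty_cst (c : R) : Linfty mu (cst c).
Proof.
by apply/LinftyP; split; [exact: measurable_cst | exists `|c|; apply: aeW].
Qed.

Lemma LinftyD u v : Linfty mu u -> Linfty mu v -> Linfty mu (u \+ v).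
Proof.
move=> /LinftyP[mu1 [M hM]] /LinftyP[mv [M' hM']]; apply/LinftyP; split.
  exact: measurable_funD.
exists (M + M'); apply: filterS2 hM hM' => x h h'.
by rewrite (le_trans (ler_normD _ _))// lerD.
Qed.

Lemma LinftyM u v : Linfty mu u -> Linfty mu v -> Linfty mu (u \* v).
Proof.
move=> /LinftyP[mu1 [M hM]] /LinftyP[mv [M' hM']]; apply/LinftyP; split.
  exact: measurable_funM.
by exists (M * M'); apply: filterS2 hM hM' => x h h'; rewrite normrM ler_pM.
Qed.

Lemma Linfty_sum (I : Type) (r : seq I) (P : pred I) (u : I -> borel X -> R) :
  (forall i, Linfty mu (u i)) -> Linfty mu (fun x => \sum_(i <- r | P i) u i x).
Proof.
move=> hu; elim: r => [|i r IH].
  by under eq_fun do rewrite big_nil; exact: Linfty_cst.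
under eq_fun do rewrite big_cons.
by case: (P i) => //; exact: LinftyD.
Qed.

Lemma Linfty_prod (I : Type) (r : seq I) (P : pred I) (u : I -> borel X -> R) :
  (forall i, Linfty mu (u i)) -> Linfty mu (fun x => \prod_(i <- r | P i) u i x).
Proof.
move=> hu; elim: r => [|i r IH].
  by under eq_fun do rewrite big_nil; exact: Linfty_cst.
under eq_fun do rewrite big_cons.
by case: (P i) => //; exact: LinftyM.
Qed.

Lemma Linfty_det n (A : borel X -> 'M[R]_n) :
  (forall i j, Linfty mu (fun x => A x i j)) -> Linfty mu (fun x => \det (A x)).
Proof.
move=> hA; rewrite /determinant; apply: Linfty_sum => s.
by apply: LinftyM; [exact: Linfty_cst | exact: Linfty_prod].
Qed.

Lemma Linfty_cofactor n (A : borel X -> 'M[R]_n) (i j : 'I_n) :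
  (forall k l, l != j -> Linfty mu (fun x => A x k l)) ->
  Linfty mu (fun x => cofactor (A x) i j).
Proof.
move=> hA; apply: LinftyM; first exact: Linfty_cst.
apply: Linfty_det => k l; under eq_fun do rewrite !mxE.
by apply: hA; rewrite eq_sym neq_lift.
Qed.

Lemma integrable_mul_Linfty g u : mu.-integrable setT (EFin \o g) ->
  Linfty mu u -> mu.-integrable setT (EFin \o (g \* u)).
Proof.
move=> ig /LinftyP[mu1 [M hM]].
have mg : measurable_fun setT g by apply/measurable_EFinP; exact: measurable_int ig.
have iM : mu.-integrable setT (fun x => `|M|%:E * (EFin \o g) x)%E.
  exact: integrableZl.
have mgu : measurable_fun setT (EFin \o (g \* u)).
  by apply/measurable_EFinP; exact: measurable_funM.
apply/integrableP; split => //.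
have /integrableP[_] := iM; apply: le_lt_trans.
apply: ae_ge0_le_integral => //.
- by apply: measurableT_comp.
- by apply: measurableT_comp => //; exact: measurable_int iM.
apply: filterS hM => x h _ /=.
rewrite lee_fin normrM normrM normr_id mulrC ler_wpM2r//.
by rewrite (le_trans h)// ler_norm.
Qed.

Lemma integral_ae_eq u v : measurable_fun setT u -> measurable_fun setT v ->
  {ae mu, forall x, u x = v x} ->
  (\int[mu]_x (u x)%:E = \int[mu]_x (v x)%:E)%E.
Proof.
move=> mu1 mv h; apply: ae_eq_integral => //; try exact/measurable_EFinP.
by apply: (@filterS _ _ (ae_filter_ringOfSetsType mu) _ _ _ h) => x /= ->.
Qed.

Lemma ae_forall_fin (I : finType) (P : I -> borel X -> Prop) :
  (forall i, {ae mu, forall x : borel X, P i x}) ->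
  {ae mu, forall x : borel X, forall i, P i x}.
Proof. by move=> h; exact: filter_forall. Qed.

(** Inner regularity and local finiteness, in a form that passes to the
    restrictions of a measure. *)
Definition compact_semifinite := forall B : set (borel X), measurable B ->
  (0 < mu B)%E -> exists K : set (borel X), [/\ compact (K : set X), K `<=` B,
    measurable K & (0 < mu K < +oo)%E].

(** Semifiniteness makes the dual of L^1 see every set of positive measure: if
    [u] is nonzero on a compact set of finite positive measure, the sign of [u]
    there is an integrable function detecting it. *)
Lemma ae_eq0_test u : compact_semifinite -> Linfty mu u ->
  (forall g, mu.-integrable setT (EFin \o g) ->
    (\int[mu]_x (g x * u x)%:E = 0)%E) ->
  {ae mu, forall x, u x = 0}.
Proof.
move=> sf Lu hu; have mu1 := Linfty_measurable Lu.
pose B : set (borel X) := [set x | u x != 0].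
have mB : measurable B.
  have -> : B = setT `&` u @^-1` (~` [set 0]).
    by rewrite setTI; apply/seteqP; split => x /= /eqP.
  by apply: mu1 => //; exact: measurableC.
suff : ~ (0 < mu B)%E.
  move=> /negP; rewrite -leNgt measure_le0 => /eqP B0.
  by exists B; split => // x /= /eqP.
move=> /(sf _ mB)[K [cK KB mK /andP[K0 Ky]]].
pose g x : R := (if u x < 0 then -1 else 1) * \1_K x.
have mg : measurable_fun setT g.
  apply: measurable_funM; last exact: measurable_indic.
  by apply: measurable_fun_ifT => //; apply: measurable_fun_ltr.
have ig : mu.-integrable setT (EFin \o g).
  have i1 : mu.-integrable setT (EFin \o (\1_K : borel X -> R)).
    apply/integrableP; split; first exact/measurable_EFinP/measurable_indic.
    rewrite (eq_integral (fun x => (\1_K x)%:E)); last first.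
      by move=> x _; rewrite gee0_abs// lee_fin indicE.
    by rewrite integral_indic ?setIT.
  apply: le_integrable i1 => //; first exact/measurable_EFinP.
  move=> x _; rewrite /= lee_fin normrM ler_piMl//.
  by case: ifP; rewrite ?normrN normr1.
have := hu _ ig.
have gu x : g x * u x = `|u x| * \1_K x.
  rewrite /g mulrAC; case: ltP => h; first by rewrite ltr0_norm// mulN1r.
  by rewrite ger0_norm// mul1r.
under eq_integral do rewrite gu.
move=> h.
have m2 : measurable_fun setT (fun x => (`|u x| * \1_K x)%:E).
  apply/measurable_EFinP; apply: measurable_funM; last exact: measurable_indic.
  exact: measurableT_comp.
have : (\int[mu]_x `|(`|u x| * \1_K x)%:E| = 0)%E.
  rewrite -[RHS]h; apply: eq_integral => x _.
  by rewrite gee0_abs// lee_fin mulr_ge0// indicE.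
move/(ae_eq_integral_abs _ measurableT m2) => /= h0.
have : mu.-negligible K.
  apply: negligibleS h0 => x Kx /= /(_ I) [].
  by rewrite indicE mem_set//= mulr1 => /eqP; rewrite normr_eq0; apply/negP/KB.
by move/(measure_negligible mK) => K00; rewrite K00 ltxx in K0.
Qed.

End Linfty.

(** * Inf-convolutions and bounded Lipschitz functions *)

Section InfConvolution.
Variables (R : realType) (T : Type) (rho : T -> T -> R).

Definition is_pseudodist := [/\ forall x, rho x x = 0,
  forall x y, rho x y = rho y x & forall y x z, rho x z <= rho x y + rho y z].

Lemma pseudodist_ge0 : is_pseudodist -> forall x y, 0 <= rho x y.
Proof.
case=> r0 rC rD x y; have := rD y x x; rewrite r0 [rho y x]rC.
by rewrite -mulr2n pmulrn_lge0.
Qed.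

(** McShane's formula, for the base points [E]. *)
Definition infconv (E : set T) (g : T -> R) (L : R) (y : T) : R :=
  inf [set g x + L * rho x y | x in E].

Variables (E : set T) (g : T -> R) (L m : R).
Hypotheses (E0 : E !=set0) (Hrho : is_pseudodist) (L0 : 0 <= L)
  (gm : forall x, E x -> m <= g x).

Lemma infconv_ge y a :
  (forall x, E x -> a <= g x + L * rho x y) -> a <= infconv E g L y.
Proof.
move=> h; apply: lb_le_inf; last by move=> _ [x Ex <-]; exact: h.
by case: E0 => x Ex; exists (g x + L * rho x y), x.
Qed.

Let has_inf_conv y : has_inf [set g x + L * rho x y | x in E].
Proof.
split; first by case: E0 => x Ex; exists (g x + L * rho x y), x.
exists m => _ [x Ex <-]; rewrite (le_trans (gm Ex))// lerDl mulr_ge0//.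
exact: pseudodist_ge0.
Qed.

Lemma infconv_le x y : E x -> infconv E g L y <= g x + L * rho x y.
Proof. by move=> Ex; apply: ge_inf; [case: (has_inf_conv y)|exists x]. Qed.

Lemma infconv_lt y e : 0 < e ->
  exists2 x, E x & g x + L * rho x y < infconv E g L y + e.
Proof. by move=> /inf_adherent /(_ (has_inf_conv y))[_ [x Ex <-] h]; exists x. Qed.

Lemma infconv_ge_lb y : m <= infconv E g L y.
Proof.
apply: infconv_ge => x Ex; rewrite (le_trans (gm Ex))// lerDl mulr_ge0//.
exact: pseudodist_ge0.
Qed.

Lemma infconv_lip y z : `|infconv E g L y - infconv E g L z| <= L * rho y z.
Proof.
have H u v : infconv E g L u - infconv E g L v <= L * rho u v.
  rewrite lerBlDl -lerBlDr; apply: infconv_ge => x Ex.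
  rewrite lerBlDr (le_trans (infconv_le _ Ex))// -addrA lerD2l -mulrDr.
  rewrite ler_wpM2l//; case: Hrho => _ rC rD.
  by rewrite [rho u v]rC rD.
rewrite ler_norml H andbT lerNl opprB; case: Hrho => _ -> _; exact: H.
Qed.

End InfConvolution.

Section Lipschitz.
Variables (R : realType) (X : pmetricType R).
Implicit Types f g : X -> R.

Lemma mdist_pseudodist (Y : metricType R) : is_pseudodist (@mdist R Y).
Proof.
by split; [exact: mdistxx|exact: metric_sym|move=> *; exact: metric_triangle].
Qed.

Lemma pseudodist_comp (T U : Type) (rho : U -> U -> R) (F : T -> U) :
  is_pseudodist rho -> is_pseudodist (fun x y => rho (F x) (F y)).
Proof. by case=> r0 rC rD; split. Qed.

Lemma pseudodist_l1 (T : Type) n (b : 'I_n -> T -> R) :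
  is_pseudodist (fun x y => \sum_(j < n) `|b j x - b j y|).
Proof.
split=> [x|x y|y x z].
- by rewrite big1// => j _; rewrite subrr normr0.
- by apply: eq_bigr => j _; rewrite distrC.
- by rewrite -big_split; apply: ler_sum => j _; exact: ler_distD.
Qed.

Lemma lipbP f : lipb f <-> (exists M, forall x, `|f x| <= M) /\
  (exists2 L, 0 <= L & forall x y, `|f x - f y| <= L * mdist x y).
Proof.
split=> [[[M [_ hM]] [L hL]]|[[M hM] [L L0 hL]]]; split.
- exists (M + 1) => x; apply: hM => //; rewrite ltrDl; exact: ltr01.
- exists `|L| => // x y; rewrite distrC; apply: le_trans (hL x y) _.
  by rewrite ler_wpM2r ?mdist_ge0// ler_norm.
- exists M; split; first exact: num_real.
  by move=> r Mr x _; apply: le_trans (hM x) _; exact: ltW.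
- by exists L => x y; apply: le_trans (hL x y); rewrite distrC.
Qed.

Lemma lipb_bounded f : lipb f -> exists M, forall x, `|f x| <= M.
Proof. by case/lipbP. Qed.

Lemma lip_const_le f L : 0 <= L ->
  (forall x y, `|f x - f y| <= L * mdist x y) -> lip_const f <= L.
Proof.
move=> L0 h; apply: ge_inf; first by exists 0 => r [].
by split => // x y; apply: le_trans (h x y); rewrite distrC.
Qed.

Lemma lipb_cst (c : R) : lipb (cst c : X -> R).
Proof.
apply/lipbP; split; first by exists `|c|.
by exists 0 => // x y; rewrite subrr normr0 mul0r.
Qed.

Lemma lipb_lin (a : R) f g : lipb f -> lipb g -> lipb (a *: f + g).
Proof.
move=> /lipbP[[M hM] [L L0 hL]] /lipbP[[M' hM'] [L' L'0 hL']].
apply/lipbP; split.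
  exists (`|a| * M + M') => x; rewrite (le_trans (ler_normD _ _))//.
  by rewrite lerD// normrM ler_wpM2l.
exists (`|a| * L + L') => [|x y]; first by rewrite addr_ge0// mulr_ge0.
rewrite [X in `|X|](_ : _ = a * (f x - f y) + (g x - g y)); last first.
  by rewrite !fctE /GRing.scale/=; lra.
rewrite (le_trans (ler_normD _ _))// mulrDl lerD// normrM -mulrA.
by rewrite ler_wpM2l.
Qed.

Lemma dist_min_le (a b c d e : R) : `|a - c| <= e -> `|b - d| <= e ->
  `|Num.min a b - Num.min c d| <= e.
Proof.
rewrite !ler_norml => /andP[? ?] /andP[? ?]; apply/andP.
by case: (leP a b) => ?; case: (leP c d) => ?; split; lra.
Qed.

Lemma dist_max_le (a b c d e : R) : `|a - c| <= e -> `|b - d| <= e ->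
  `|Num.max a b - Num.max c d| <= e.
Proof.
rewrite !ler_norml => /andP[? ?] /andP[? ?]; apply/andP.
by case: (leP a b) => ?; case: (leP c d) => ?; split; lra.
Qed.

Lemma lipb_max f g : lipb f -> lipb g -> lipb (fun x => Num.max (f x) (g x)).
Proof.
move=> /lipbP[[M hM] [L L0 hL]] /lipbP[[M' hM'] [L' L'0 hL']].
apply/lipbP; split.
  exists (Num.max M M') => x; rewrite le_max.
  by case: (leP (f x) (g x)) => _; rewrite ?hM ?hM'// orbT.
exists (Num.max L L') => [|x y]; first by rewrite le_max L0.
by apply: dist_max_le; [apply: le_trans (hL x y) _|apply: le_trans (hL' x y) _];
  rewrite ler_wpM2r ?mdist_ge0// le_max lexx ?orbT.
Qed.

Lemma lipb_min f g : lipb f -> lipb g -> lipb (fun x => Num.min (f x) (g x)).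
Proof.
move=> /lipbP[[M hM] [L L0 hL]] /lipbP[[M' hM'] [L' L'0 hL']].
apply/lipbP; split.
  exists (Num.max M M') => x; rewrite le_max.
  by case: (leP (f x) (g x)) => _; rewrite ?hM ?hM'// orbT.
exists (Num.max L L') => [|x y]; first by rewrite le_max L0.
by apply: dist_min_le; [apply: le_trans (hL x y) _|apply: le_trans (hL' x y) _];
  rewrite ler_wpM2r ?mdist_ge0// le_max lexx ?orbT.
Qed.

Lemma lipb_abs f : lipb f -> lipb (fun x => `|f x|).
Proof.
move=> /lipbP[[M hM] [L L0 hL]]; apply/lipbP; split.
  by exists M => x; rewrite normr_id.
by exists L => // x y; exact: le_trans (ler_dist_dist _ _) (hL x y).
Qed.

(** McShane's extension, truncated so as to keep the bound. *)
Lemma lipb_extension (E : set X) f M L : 0 <= L ->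
  (forall x, E x -> `|f x| <= M) ->
  (forall x y, E x -> E y -> `|f x - f y| <= L * mdist x y) ->
  exists2 h, lipb h & forall x, E x -> h x = f x.
Proof.
move=> L0 hM hL; have [[x0 Ex0]|E0] := pselect (E !=set0); last first.
  exists (cst 0); first exact: lipb_cst.
  by move=> x Ex; case: E0; exists x.
pose h0 := infconv mdist E f L.
have fM x : E x -> - M <= f x.
  by move=> /hM; rewrite ler_norml => /andP[].
have E0 : E !=set0 by exists x0.
have h0f x : E x -> h0 x = f x.
  move=> Ex; apply/eqP; rewrite eq_le; apply/andP; split.
    have := @infconv_le _ _ _ E f L (- M) E0 (mdist_pseudodist X) L0 fM x x Ex.
    by rewrite mdistxx mulr0 addr0.
  apply: infconv_ge => // y Ey; have := hL _ _ Ex Ey.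
  by rewrite ler_norml metric_sym => /andP[_]; lra.
exists (fun x => Num.min (h0 x) M) => [|x Ex]; last first.
  rewrite h0f//; apply/min_idPl; have := hM _ Ex.
  by rewrite ler_norml => /andP[].
apply/lipbP; split.
  exists (`|M|) => x; rewrite ler_norml.
  have := @infconv_ge_lb _ _ _ E f L (- M) E0 (mdist_pseudodist X) L0 fM x.
  rewrite -/(h0 x) le_min ge_min ler_norm orbT andbT => ?.
  have := ler_norm M; have := ler_norm (- M); rewrite normrN => ? ?.
  by apply/andP; split; lra.
exists L => // x y; apply: dist_min_le.
  exact: (infconv_lip (m := - M)) (mdist_pseudodist X) _ _ _ _.
by rewrite subrr normr0 mulr_ge0// mdist_ge0.
Qed.

End Lipschitz.

(** * Locality of derivations *)

Section Borel.
Variables (R : realType) (X : pmetricType R).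

Lemma lip_continuous (Y Z : metricType R) (F : Y -> Z) (L : R) :
  is_lipschitz L F -> continuous F.
Proof.
move=> hF x; apply/cvg_ballP => e e0.
have L0 : 0 < `|L| + 1 by rewrite ltr_wpDl.
apply/nbhs_ballP; exists (e / (`|L| + 1)); first by rewrite /= divr_gt0.
move=> y; rewrite /= !ballEmdist /= ltr_pdivlMr// => h.
apply: le_lt_trans (hF x y) _; apply: le_lt_trans h; rewrite mulrC.
by rewrite ler_wpM2l ?mdist_ge0// (le_trans (ler_norm _))// lerDl.
Qed.

Lemma borel_open (A : set (borel X)) : open (A : set X) -> measurable A.
Proof. exact: sub_sigma_algebra. Qed.

Lemma borel_closed (A : set (borel X)) : closed (A : set X) -> measurable A.
Proof.
move=> cA; rewrite -[A]setCK; apply: measurableC; apply: borel_open.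
exact: closed_openC.
Qed.

Lemma lipb_zero_measurable (f : X -> R) : lipb f ->
  measurable ([set x | f x = 0] : set (borel X)).
Proof.
case=> _ [L hL]; apply: borel_closed.
have cf : continuous (f : X -> R^o) by exact: lip_continuous hL.
have -> : [set x | f x = 0] = f @^-1` [set 0] by [].
apply: closed_comp => [x _|]; first exact: cf.
exact: closed_eq.
Qed.

End Borel.

Section Derivation.
Variables (R : realType) (X : pmetricType R).
Variable mu : {measure set (borel X) -> \bar R}.
Hypothesis sf : compact_semifinite mu.
Variable D : (X -> R) -> borel X -> R.
Hypothesis dD : is_derivation mu D.
Implicit Types f g h : X -> R.

Lemma der_lin3 a f g h : lipb f -> lipb g -> (forall x, h x = a * f x + g x) ->
  {ae mu, forall x : borel X, D h x = a * D f x + D g x}.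
Proof.
move=> lf lg hE; have -> : h = a *: f + g by apply/funext => x; rewrite hE.
exact: der_linear.
Qed.

Lemma der_cst (c : R) : {ae mu, forall x, D (cst c) x = 0}.
Proof.
have D0 : {ae mu, forall x, D (cst 0) x = 0}.
  have e (x : X) : cst 0 x = -1 * cst 0 x + cst 0 x :> R by rewrite /= mulr0 addr0.
  have := der_lin3 (lipb_cst X 0) (lipb_cst X 0) e.
  by apply: filterS => x h; lra.
have D1 : {ae mu, forall x, D (cst 1) x = 0}.
  have := der_leibniz dD (lipb_cst X 1) (lipb_cst X 1).
  have -> : (cst 1 : X -> R) * cst 1 = cst 1 by apply/funext => x; rewrite fctE mulr1.
  by apply: filterS => x /= h; lra.
have e (x : X) : cst c x = c * cst 1 x + cst 0 x :> R by rewrite /= mulr1 addr0.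
have := der_lin3 (lipb_cst X 1) (lipb_cst X 0) e.
by apply: filterS3 D0 D1 => x -> -> ->; rewrite mulr0 addr0.
Qed.

Let clamp (n : nat) f x := Num.max (- n.+1%:R^-1) (Num.min (f x) n.+1%:R^-1).

Let clamp_lipb n f : lipb f -> lipb (clamp n f).
Proof.
by move=> lf; apply: lipb_max; [exact: lipb_cst | apply: lipb_min => //; exact: lipb_cst].
Qed.

Let clamp_cvg f : lipb f -> lipb_weak_cvg (fun n => clamp n f) (cst 0).
Proof.
move=> /lipbP[_ [L L0 hL]]; split.
  exists L => n; apply: lip_const_le => // x y.
  by apply: dist_max_le; [|apply: dist_min_le => //];
    rewrite subrr normr0 mulr_ge0 ?mdist_ge0.
move=> x; apply: (@squeeze_cvgr _ _ _ _ (fun n => - harmonic n) harmonic).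
- near=> n; rewrite /clamp /harmonic le_max lexx/= ge_max ge_min lexx orbT andbT.
  by apply: (@le_trans _ _ 0); rewrite ?oppr_le0 invr_ge0.
- by rewrite -oppr0; apply: cvgN; exact: cvg_harmonic.
- exact: cvg_harmonic.
Unshelve. all: by end_near. Qed.

(** [f] minus its truncation at height [1/(n+1)] is killed by a cutoff function
    equal to 1 on the zero set, so the Leibniz rule shows that [f] and its
    truncations have the same derivative there; and the truncations tend to 0. *)
Lemma der_zero_set f : lipb f -> {ae mu, forall x : borel X, f x = 0 -> D f x = 0}.
Proof.
move=> lf; pose Z : set (borel X) := [set x | f x = 0].
have mZ : measurable Z by exact: lipb_zero_measurable.
have Dclamp n : {ae mu, forall x : borel X, f x = 0 -> D f x = D (clamp n f) x}.
  pose fn x := f x - clamp n f x.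
  pose psi x := Num.max 0 (1 - n.+1%:R * `|f x|).
  have lfn : lipb fn.
    have -> : fn = -1 *: clamp n f + f.
      by apply/funext => x; rewrite /fn fctE/= scaleN1r addrC.
    by apply: lipb_lin => //; exact: clamp_lipb.
  have lpsi : lipb psi.
    apply: lipb_max; first exact: lipb_cst.
    have -> : (fun x => 1 - n.+1%:R * `|f x|) =
        (- n.+1%:R) *: (fun x => `|f x|) + cst 1.
      by apply/funext => x; rewrite fctE /= addrC -mulNr.
    by apply: lipb_lin; [exact: lipb_abs | exact: lipb_cst].
  have psifn : psi * fn = cst 0.
    apply/funext => x; rewrite fctE /psi /fn /clamp /=.
    have n0 : (0 : R) < n.+1%:R by [].
    have [h|h] := lerP (n.+1%:R^-1) `|f x|.
      rewrite max_l ?mul0r// subr_le0 -ler_pdivrMl// mulr1//.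
    move: h; rewrite ltr_norml => /andP[/ltW h1 /ltW h2].
    by rewrite (min_l h2) (max_r h1) subrr mulr0.
  have := der_leibniz dD lpsi lfn; rewrite psifn.
  have e x : f x = 1 * clamp n f x + fn x by rewrite /fn mul1r addrC subrK.
  have := der_lin3 (clamp_lipb n lf) lfn e.
  apply: filterS3 (der_cst 0) => x -> -> + fx0.
  rewrite /psi /fn /clamp fx0 normr0 mulr0 subr0 max_r//.
  rewrite min_l// max_r ?oppr_le0// subrr mul0r addr0 !mul1r => <-.
  by rewrite addr0.
pose u := D f \* \1_Z.
have Lu : Linfty mu u.
  apply: LinftyM; first exact: (der_Linfty dD).
  apply/LinftyP; split; first exact: measurable_indic.
  by exists 1; apply: aeW => x; rewrite indicE normr_nat lern1 leq_b1.
have : {ae mu, forall x, u x = 0}.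
  apply: ae_eq0_test => // g ig.
  have LZ : Linfty mu \1_Z.
    apply/LinftyP; split; first exact: measurable_indic.
    by exists 1; apply: aeW => x; rewrite indicE normr_nat lern1 leq_b1.
  have igZ := integrable_mul_Linfty ig LZ.
  have mgD h : lipb h -> measurable_fun setT (fun x => (g \* \1_Z) x * D h x).
    move=> /(der_Linfty dD) Lh; have := integrable_mul_Linfty igZ Lh.
    by move/measurable_int/measurable_EFinP.
  have := @der_weak_continuous _ _ _ _ dD _ _ (fun n => clamp_lipb n lf) (lipb_cst X 0)
    (clamp_cvg lf) _ igZ.
  have -> : (fun n => \int[mu]_x ((g \* \1_Z) x * D (clamp n f) x)%:E)%E =
            (fun n => \int[mu]_x ((g \* \1_Z) x * D f x)%:E)%E.
    apply/funext => n; apply: integral_ae_eq.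
    - by apply: mgD; exact: clamp_lipb.
    - exact: mgD.
    apply: filterS (Dclamp n) => x hx.
    rewrite /= indicE; case: (boolP (x \in Z)) => xZ; last by rewrite mulr0 !mul0r.
    by rewrite hx//; move/set_mem: xZ.
  have -> : (\int[mu]_x ((g \* \1_Z) x * D (cst 0%R) x)%:E = 0)%E.
    rewrite -[RHS](integral0 mu setT); apply: integral_ae_eq.
    - by apply: mgD; exact: lipb_cst.
    - exact: measurable_cst.
    by apply: filterS (der_cst 0) => x ->; rewrite mulr0.
  move=> /(cvg_unique _ (cvg_cst _)) => h.
  rewrite -[RHS]h //; apply: eq_integral => x _; congr EFin.
  by rewrite /u/= mulrA mulrAC.
apply: filterS => x + fx0; rewrite /u /= indicE mem_set//= mulr1.
exact.
Qed.

(** The difference of the two functions vanishes where they agree. *)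
Lemma der_local f g : lipb f -> lipb g ->
  {ae mu, forall x : borel X, f x = g x -> D f x = D g x}.
Proof.
move=> lf lg; pose h x := -1 * f x + g x.
have lh : lipb h by exact: lipb_lin.
apply: filterS2 (der_zero_set lh) (der_lin3 lf lg (fun x => erefl (h x))).
move=> x h0 h1 fg; suff : D h x = 0 by rewrite h1; lra.
by apply: h0; rewrite /h fg; lra.
Qed.

End Derivation.

(** * Determinants of derivatives under weak* limits *)

Section Jacobian.
Variables (R : realType) (X : pmetricType R).
Variable mu : {measure set (borel X) -> \bar R}.
Hypothesis sf : compact_semifinite mu.
Variables (n : nat) (D : 'I_n -> (X -> R) -> borel X -> R).
Hypothesis dD : forall i, is_derivation mu (D i).

Definition jac m (f : 'I_m -> X -> R) (x : borel X) : 'M[R]_(n, m) :=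
  \matrix_(i, j) D i (f j) x.

Lemma jac_cofactor (f f' : 'I_n -> X -> R) (j : 'I_n) x i :
  (forall k, k != j -> f k = f' k) ->
  cofactor (jac f x) i j = cofactor (jac f' x) i j.
Proof.
move=> ff'; congr (_ * \det _); apply/matrixP => k l; rewrite !mxE ff'//.
by rewrite eq_sym neq_lift.
Qed.

Lemma Linfty_jac_cofactor (f : 'I_n -> X -> R) (i j : 'I_n) :
  (forall k, lipb (f k)) -> Linfty mu (fun x => cofactor (jac f x) i j).
Proof.
move=> lf; apply: Linfty_cofactor => k l _; under eq_fun do rewrite mxE.
exact: (der_Linfty (dD _)).
Qed.

Lemma Linfty_jac_det (f : 'I_n -> X -> R) :
  (forall k, lipb (f k)) -> Linfty mu (fun x => \det (jac f x)).
Proof.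
move=> lf; apply: Linfty_det => k l; under eq_fun do rewrite mxE.
exact: (der_Linfty (dD _)).
Qed.

Lemma cvg_esum_fin (I : Type) (r : seq I) (u : I -> nat -> \bar R)
    (l : I -> \bar R) :
  (forall i, u i k @[k --> \oo] --> l i) -> (forall i, l i \is a fin_num) ->
  (\sum_(i <- r) u i k)%E @[k --> \oo] --> (\sum_(i <- r) l i)%E.
Proof.
move=> hu hl; elim: r => [|i r IH].
  by rewrite big_nil; under eq_fun do rewrite big_nil; exact: cvg_cst.
rewrite big_cons; under eq_fun do rewrite big_cons.
by apply: cvgeD => //; rewrite fin_num_adde_defr.
Qed.

(** Each column enters linearly, against a cofactor that is a bounded function
    independent of that column: this is what makes the determinant continuous
    under weak* limits taken in one column at a time. *)
Lemma det_jac_column_limit (f : 'I_n -> X -> R) (j : 'I_n)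
    (fk : nat -> X -> R) :
  (forall k, lipb (f k)) -> (forall k, lipb (fk k)) ->
  lipb_weak_cvg fk (f j) ->
  (forall k, {ae mu, forall x,
    \det (jac (fun l => if l == j then fk k else f l) x) = 0}) ->
  {ae mu, forall x, \det (jac f x) = 0}.
Proof.
move=> lf lfk fkf det0; apply: ae_eq0_test => // [|g ig].
  exact: Linfty_jac_det.
pose h i x := g x * cofactor (jac f x) i j.
have ih i : mu.-integrable setT (EFin \o h i).
  by apply: integrable_mul_Linfty => //; exact: Linfty_jac_cofactor.
have ihD i p : lipb p -> mu.-integrable setT (fun x => (h i x * D i p x)%:E).
  by move=> lp; apply: integrable_mul_Linfty => //; exact: (der_Linfty (dD i)).
have expand p : lipb p ->
    (\int[mu]_x (g x * \det (jac (fun l => if l == j then p else f l) x))%:E =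
     \sum_(i < n) \int[mu]_x (h i x * D i p x)%:E)%E.
  move=> lp; rewrite -integral_sum//; last by move=> i; exact: ihD.
  apply: eq_integral => x _; rewrite sumEFin (expand_det_col _ j) mulr_sumr.
  congr EFin; apply: eq_bigr => i _; rewrite mxE eqxx mulrCA mulrC.
  rewrite (@jac_cofactor _ f)// => k kj; by rewrite (negbTE kj).
have -> : (\int[mu]_x (g x * \det (jac f x))%:E =
           \sum_(i < n) \int[mu]_x (h i x * D i (f j) x)%:E)%E.
  rewrite -expand//; apply: eq_integral => x _; congr (EFin (_ * \det (jac _ _))).
  by apply/funext => l; case: eqP => [->|].
have : (\sum_(i < n) \int[mu]_x (h i x * D i (fk k) x)%:E)%E @[k --> \oo] -->
       (\sum_(i < n) \int[mu]_x (h i x * D i (f j) x)%:E)%E.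
  apply: cvg_esum_fin => i; last exact/integrable_fin_num/ihD.
  exact: (der_weak_continuous (dD i)).
have -> : (fun k => \sum_(i < n) \int[mu]_x (h i x * D i (fk k) x)%:E)%E = cst 0%E.
  apply/funext => k; rewrite -expand//= -[RHS](integral0 mu setT).
  pose fl l := if l == j then fk k else f l.
  have lfl l : lipb (fl l) by rewrite /fl; case: ifP.
  apply: integral_ae_eq; last by apply: filterS (det0 k) => x ->; rewrite mulr0.
    have := integrable_mul_Linfty ig (Linfty_jac_det lfl).
    by move/measurable_int/measurable_EFinP.
  exact: measurable_cst.
by move/(cvg_unique _ (cvg_cst _)) => /(_ (@ereal_hausdorff R)).
Qed.

Lemma det_jac_closure (A B : set (X -> R)) : A `<=` @lipb R X ->
  B `<=` @lipb R X ->
  (forall f, B f -> exists2 fk : nat -> X -> R, (forall k, A (fk k)) &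
    lipb_weak_cvg fk f) ->
  (forall f, (forall j, A (f j)) -> {ae mu, forall x, \det (jac f x) = 0}) ->
  forall f, (forall j, B (f j)) -> {ae mu, forall x, \det (jac f x) = 0}.
Proof.
move=> Al Bl AB det0 f Bf.
(* columns of index less than [k] range over [B], the others over [A] *)
suff H k : forall f, (forall j : 'I_n, (j < k)%N -> B (f j)) ->
    (forall j : 'I_n, (k <= j)%N -> A (f j)) ->
    {ae mu, forall x, \det (jac f x) = 0}.
  by apply: (H n) => // j; rewrite leqNgt ltn_ord.
elim: k => [|k IH] {Bf}f Bf Af; first by apply: det0 => j; exact: Af.
have [kn|nk] := ltnP k n; last first.
  apply: IH => j jk; first by apply: Bf; exact: ltnW.
  by have := leq_trans nk jk; rewrite leqNgt ltn_ord.
pose j0 := Ordinal kn.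
have [fk Afk fkf] := AB _ (Bf j0 (ltnSn k)).
have lf j : lipb (f j).
  by case: (ltnP j k.+1) => h; [apply: Bl; exact: Bf|apply: Al; exact: Af].
apply: (@det_jac_column_limit f j0 fk) => // [m|m]; first exact: Al.
apply: IH => j jk.
  have -> : (j == j0) = false by apply/negbTE; rewrite -val_eqE /= ltn_eqF.
  by apply: Bf; exact: ltnW.
have [//|jj0] := eqVneq j j0; apply: Af.
by rewrite ltn_neqAle jk andbT eq_sym.
Qed.

Section Gradient.
Variables (N : nat) (b : 'I_N -> X -> R).
Hypothesis lb : forall j, lipb (b j).

(** The partial derivatives [c] serve for all the derivations: this is what
    bounds the rank of the Jacobian matrix. *)
Definition has_gradient (f : X -> R) := lipb f /\
  exists c : borel X -> 'I_N -> R, {ae mu, forall x : borel X, forall i,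
    D i f x = \sum_(j < N) c x j * D i (b j) x}.

Lemma has_gradient_lipb f : has_gradient f -> lipb f. Proof. by case. Qed.

Lemma has_gradient_cst (a : R) : has_gradient (cst a).
Proof.
split; first exact: lipb_cst.
exists (fun _ _ => 0).
have h0 : {ae mu, forall x : borel X, forall i, D i (cst a) x = 0}.
  by apply: ae_forall_fin => i; exact: der_cst.
apply: filterS h0 => x h i.
by rewrite h big1// => j _; rewrite mul0r.
Qed.

Lemma has_gradient_base k : has_gradient (b k).
Proof.
split=> //; exists (fun _ j => (j == k)%:R); apply: aeW => x i.
rewrite (bigD1 k)//= eqxx mul1r big1 ?addr0// => j /negbTE ->.
by rewrite mul0r.
Qed.

Lemma has_gradient_lin a f g : has_gradient f -> has_gradient g ->
  has_gradient (a *: f + g).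
Proof.
move=> [lf [c hc]] [lg [d hd]]; split; first exact: lipb_lin.
exists (fun x j => a * c x j + d x j).
have : {ae mu, forall x : borel X, forall i,
    D i (a *: f + g) x = a * D i f x + D i g x}.
  by apply: ae_forall_fin => i; exact: der_linear.
apply: filterS3 hc hd => x hc hd h i; rewrite h hc hd mulr_sumr -big_split.
by apply: eq_bigr => j _; rewrite /= mulrDl mulrA.
Qed.

Lemma has_gradient_sum (I : Type) (r : seq I) (f : I -> X -> R) :
  (forall i, has_gradient (f i)) -> has_gradient (fun x => \sum_(i <- r) f i x).
Proof.
move=> hf; elim: r => [|i r IH].
  by under eq_fun do rewrite big_nil; exact: has_gradient_cst.
under eq_fun do rewrite big_cons.
have -> : (fun x => f i x + \sum_(j <- r) f j x) =
    1 *: f i + (fun x => \sum_(j <- r) f j x).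
  by rewrite scale1r.
exact: has_gradient_lin.
Qed.

(** By locality, [h] has the derivatives of [f] where it equals [f], and those
    of [g] elsewhere; minima, maxima and absolute values are instances. *)
Lemma has_gradient_select f g h : has_gradient f -> has_gradient g -> lipb h ->
  (forall x, h x = f x \/ h x = g x) -> has_gradient h.
Proof.
move=> [lf [c hc]] [lg [d hd]] lh hE; split => //.
exists (fun x => if h x == f x then c x else d x).
have hf : {ae mu, forall x : borel X, forall i, h x = f x -> D i h x = D i f x}.
  by apply: ae_forall_fin => i; exact: der_local.
have hg : {ae mu, forall x : borel X, forall i, h x = g x -> D i h x = D i g x}.
  by apply: ae_forall_fin => i; exact: der_local.
apply: filterS2 (filterI hc hd) (filterI hf hg) => x [hcx hdx] [hfx hgx] i.
case: eqP => hfe; first by rewrite hfx.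
by rewrite hgx//; case: (hE x).
Qed.

Lemma has_gradient_min f g : has_gradient f -> has_gradient g ->
  has_gradient (fun x => Num.min (f x) (g x)).
Proof.
move=> hf hg; apply: (has_gradient_select hf hg).
  by apply: lipb_min; exact: has_gradient_lipb.
by move=> x; case: leP; [left|right].
Qed.

Lemma has_gradient_dist k a : has_gradient (fun x => `|b k x - a|).
Proof.
have h1 : has_gradient (fun x => b k x - a).
  have -> : (fun x => b k x - a) = 1 *: b k + cst (- a) by rewrite scale1r.
  by apply: has_gradient_lin; [exact: has_gradient_base|exact: has_gradient_cst].
have h2 : has_gradient (fun x => a - b k x).
  have -> : (fun x => a - b k x) = -1 *: b k + cst a.
    by apply/funext => x; rewrite scaleN1r addrC.
  by apply: has_gradient_lin; [exact: has_gradient_base|exact: has_gradient_cst].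
apply: (has_gradient_select h1 h2).
  by apply: lipb_abs; exact: has_gradient_lipb h1.
move=> x; case: (leP 0 (b k x - a)) => h; first by left; rewrite ger0_norm.
by right; rewrite ltr0_norm// opprB.
Qed.

(** The Jacobian matrix factors through [R^N] at almost every point. *)
Lemma det_jac_gradient (f : 'I_n -> X -> R) : (N < n)%N ->
  (forall k, has_gradient (f k)) -> {ae mu, forall x, \det (jac f x) = 0}.
Proof.
move=> Nn hf; pose c k := sval (cid (hf k).2).
have hc k := svalP (cid (hf k).2).
apply: filterS (ae_forall_fin hc) => x hx.
have -> : jac f x = jac b x *m (\matrix_(j < N, k < n) c k x j).
  apply/matrixP => i k; rewrite !mxE hx; apply: eq_bigr => j _.
  by rewrite !mxE mulrC.
apply/eqP; rewrite -[_ == 0]negbK -unitfE -unitmxE -row_free_unit.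
apply/negP => /eqP h.
have := mulmx_max_rank (jac b x) (\matrix_(j < N, k < n) c k x j).
by rewrite h leqNgt Nn.
Qed.

End Gradient.
End Jacobian.

(** * Lipschitz functions of finitely many functions *)

Section Approximation.
Variables (R : realType) (X : pmetricType R) (N : nat) (b : 'I_N -> X -> R).

Lemma dense_sequence (T : Type) (c : 'I_N -> T -> R) (E : set T) : E !=set0 ->
  exists2 y : nat -> T, (forall k, E (y k)) &
    forall x e, E x -> 0 < e ->
      exists k, \sum_(j < N) `|c j (y k) - c j x| < e.
Proof.
move=> [y0 Ey0].
(* the points of [E] are sorted into the cells of cubic grids of mesh 1/(m+1),
   and one point of [E] is chosen in each cell that contains one *)
pose cell (m : nat) (x : T) : {ffun 'I_N -> int} :=
  [ffun j => Num.floor (m.+1%:R * c j x)].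
have pick (zm : {ffun 'I_N -> int} * nat) :
    {y | E y & forall x, E x -> cell zm.2 x = zm.1 -> cell zm.2 y = zm.1}.
  have [h|h] := pselect (exists x, E x /\ cell zm.2 x = zm.1).
    by apply: cid2; case: h => x [Ex xz]; exists x.
  by exists y0 => // x Ex xz; case: h; exists x.
pose y k := if choice.unpickle k is Some zm
            then s2val (pick zm) else y0.
exists y => [k|x e Ex e0].
  by rewrite /y; case: choice.unpickle => // zm; case: (pick zm).
pose m := Num.truncn (N%:R / e).
exists (choice.pickle (cell m x, m)); rewrite /y choice.pickleK.
case: (pick _) => z /= _ /(_ x Ex erefl) zx.
apply: (@le_lt_trans _ _ (\sum_(j < N) m.+1%:R^-1)); last first.
  rewrite sumr_const card_ord -[X in X < _]mulr_natl ltr_pdivrMr// mulrC -ltr_pdivrMr//.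
  exact: truncnS_gt.
apply: ler_sum => j _.
have m0 : (0 : R) < m.+1%:R by [].
rewrite -[X in _ <= X]mulr1 ler_pdivlMl// -{1}(gtr0_norm m0) -normrM mulrBr.
have := congr1 (fun f : {ffun 'I_N -> int} => f j) zx; rewrite !ffunE => fl.
have := floor_le (m.+1%:R * c j x); have := floorD1_gt (m.+1%:R * c j x).
have := floor_le (m.+1%:R * c j z); have := floorD1_gt (m.+1%:R * c j z).
rewrite fl intrD => h1 h2 h3 h4.
by rewrite ler_norml; apply/andP; split; lra.
Qed.

Hypothesis lb : forall j, lipb (b j).

Let rho x y := \sum_(j < N) `|b j x - b j y|.

Let rhoP : is_pseudodist rho. Proof. exact: pseudodist_l1 b. Qed.

Lemma l1_dist_lip : exists2 K, 0 <= K & forall x y, rho x y <= K * mdist x y.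
Proof.
have /(_ _)/cid2 K j := ((lipbP (b j)).1 (lb j)).2.
exists (\sum_j s2val (K j)) => [|x y].
  by apply: sumr_ge0 => j _; case: (K j).
by rewrite mulr_suml; apply: ler_sum => j _; case: (K j).
Qed.

(** McShane's formula [inf_k f (y k) + L * rho (y k) x], over a sequence dense
    in [E], is the pointwise limit of minima of finitely many functions which
    are sums of the [|b j - b j (y k)|]. *)
Lemma gradient_approximation (mu : {measure set (borel X) -> \bar R})
    (n : nat) (D : 'I_n -> (X -> R) -> borel X -> R) (E : set X) (f : X -> R) L :
  compact_semifinite mu -> (forall i, is_derivation mu (D i)) ->
  lipb f -> 0 <= L ->
  (forall x y, E x -> E y -> `|f x - f y| <= L * rho x y) ->
  exists2 h, lipb h /\ (forall x, E x -> h x = f x) &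
    exists2 fk : nat -> X -> R, (forall k, has_gradient mu D b (fk k)) &
      lipb_weak_cvg fk h.
Proof.
move=> sf dD lf L0 hL.
have [E0|nE] := pselect (E !=set0); last first.
  exists (cst 0); first by split=> [|x Ex]; [exact: lipb_cst|case: nE; exists x].
  exists (fun _ => cst 0) => [k|]; first exact: has_gradient_cst.
  split=> [|x]; last exact: cvg_cst.
  by exists 0 => _; apply: lip_const_le => // x y; rewrite subrr normr0 mul0r.
have [y Ey dy] := dense_sequence b E0.
have [M hM] := lipb_bounded lf.
have [K K0 hK] := l1_dist_lip.
have y0 : range y !=set0 by exists (y 0%N), 0%N.
have fM x : range y x -> - M <= f x.
  by move=> _; have := hM x; rewrite ler_norml => /andP[].
pose h := infconv rho (range y) f L.
pose t k x := f (y k) + L * rho x (y k).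
pose fk := fix fk k := if k is k'.+1 then fun x => Num.min (fk k' x) (t k x)
                       else t 0%N.
have ht k x : h x <= t k x.
  rewrite /t; case: rhoP => _ -> _.
  by apply: (infconv_le y0 rhoP L0 fM); exists k.
have hfk k x : h x <= fk k x.
  by elim: k => [|k IH] /=; [exact: ht|rewrite le_min IH ht].
have fkt k l x : (l <= k)%N -> fk k x <= t l x.
  elim: k => [|k IH]; first by rewrite leqn0 => /eqP ->.
  rewrite leq_eqVlt => /orP[/eqP ->|]; first by rewrite /= ge_min lexx orbT.
  by rewrite ltnS => /IH h1; rewrite /= ge_min h1.
have tlip k u v : `|t k u - t k v| <= L * rho u v.
  rewrite /t opprD addrACA subrr add0r -mulrBr normrM ger0_norm// ler_wpM2l//.
  case: rhoP => _ rC rD; rewrite ler_norml.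
  have := rD v u (y k); have := rD u v (y k); rewrite (rC v u) => ? ?.
  by apply/andP; split; lra.
have fklip k u v : `|fk k u - fk k v| <= L * rho u v.
  by elim: k => [|k IH] /=; [exact: tlip|apply: dist_min_le].
have LK u v : L * rho u v <= (L * K) * mdist u v.
  by rewrite -mulrA ler_wpM2l.
have tg k : has_gradient mu D b (t k).
  have -> : t k = L *: (fun x => \sum_(j < N) `|b j x - b j (y k)|) + cst (f (y k)).
    by apply/funext => x; rewrite /t addrC.
  apply: has_gradient_lin => //; last exact: has_gradient_cst.
  by apply: has_gradient_sum => // j; exact: has_gradient_dist.
exists h; first split.
- apply/lipbP; split.
    have [M0 hM0] := lipb_bounded (has_gradient_lipb (tg 0%N)).
    exists (Num.max M M0) => x; rewrite ler_norml le_max.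
    have := infconv_ge_lb y0 rhoP L0 fM x; rewrite -/(h x) => Mh.
    rewrite (le_trans _ Mh) ?lerN2 ?le_max ?lexx//=.
    have := le_trans (ht 0%N x) (le_trans (ler_norm _) (hM0 x)) => ->.
    by rewrite orbT.
  exists (L * K) => [|u v]; first exact: mulr_ge0.
  by apply: le_trans (LK u v); exact: (infconv_lip y0 rhoP L0 fM).
- move=> x Ex; apply/eqP; rewrite eq_le; apply/andP; split; last first.
    apply: infconv_ge => // _ [k _ <-]; have := hL _ _ (Ey k) Ex.
    by rewrite ler_norml => /andP[]; lra.
  apply/ler_addgt0Pl => e e0.
  (* if [rho (y k) x < d], then [t k x <= f x + 2 * L * d] *)
  have e1 : 0 < e / (2 * L + 1) by rewrite divr_gt0// ltr_wpDl// mulr_ge0.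
  have [k hk] := dy _ _ Ex e1.
  have yx : rho (y k) x * (2 * L + 1) < e by rewrite -ltr_pdivlMr// ltr_wpDl// mulr_ge0.
  apply: le_trans (ht k x) _; rewrite /t; case: (rhoP) => _ -> _.
  have := hL _ _ (Ey k) Ex; rewrite ler_norml => /andP[_].
  have := pseudodist_ge0 rhoP (y k) x; lra.
exists fk => [k|].
  by elim: k => [|k IH] /=; [exact: tg|exact: has_gradient_min].
split.
  exists (L * K) => k; apply: lip_const_le; first exact: mulr_ge0.
  by move=> u v; apply: le_trans (LK u v).
move=> x; apply/cvgrPdist_lt => e e0.
have [_ [k _ <-] hk] := infconv_lt y0 rhoP L0 fM x e0.
near=> m; rewrite distrC ger0_norm ?subr_ge0// ltrBlDl.
apply: le_lt_trans (fkt _ k _ _) _; first by near: m; exact: nbhs_infty_ge.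
by rewrite /t; case: rhoP => _ -> _.
Unshelve. all: by end_near. Qed.

End Approximation.

(** * Norms and simplices *)

Lemma norm_lip_continuous (R : realType) (V : normedModType R) (f : V -> R) K :
  0 <= K -> (forall u v, `|f u - f v| <= K * `|u - v|) -> continuous f.
Proof.
move=> K0 hf u; apply/cvgrPdist_lt => e e0.
have K1 : 0 < K + 1 by rewrite ltr_wpDl.
have : \forall v \near u, `|u - v| < e / (K + 1).
  by apply: cvgr_dist_lt; rewrite ?divr_gt0.
apply: filterS => v; rewrite ltr_pdivlMr// => uv.
apply: le_lt_trans (hf u v) _; apply: le_lt_trans uv.
by rewrite mulrC ler_wpM2l// lerDl.
Qed.

Section FiniteDimensionalNorm.
Variables (R : realType) (I : finType) (nu : {ffun I -> R} -> R).
Hypothesis Hnu : is_norm nu.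

Lemma is_norm0 : nu 0 = 0.
Proof. by case: Hnu => _ /(_ 0 0) h _; rewrite -(scale0r 0) h normr0 mul0r. Qed.

Lemma is_normN u : nu (- u) = nu u.
Proof. by case: Hnu => _ /(_ (-1) u) h _; rewrite -scaleN1r h normrN1 mul1r. Qed.

Lemma is_norm_ge0 u : 0 <= nu u.
Proof.
case: Hnu => hD _ _; have := hD u (- u).
by rewrite subrr is_norm0 is_normN -mulr2n pmulrn_lge0.
Qed.

Lemma is_norm_dist u v : `|nu u - nu v| <= nu (u - v).
Proof.
case: Hnu => hD _ _; have := hD (u - v) v; have := hD (v - u) u.
rewrite !subrK -(opprB u v) is_normN ler_norml => ? ?.
by apply/andP; split; lra.
Qed.

(** Expand [u] in the canonical basis. *)
Lemma is_norm_le_l1 : exists2 C, 0 <= C &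
  forall u : {ffun I -> R}, nu u <= C * \sum_v `|u v|.
Proof.
pose dl (w : I) : {ffun I -> R} := [ffun v => (v == w)%:R].
exists (\sum_w nu (dl w)) => [|u].
  by apply: sumr_ge0 => w _; exact: is_norm_ge0.
have uE : u = \sum_w u w *: dl w.
  apply/ffunP => v; rewrite sum_ffunE (bigD1 v)//= !ffunE eqxx.
  rewrite big1 ?addr0; first by rewrite /GRing.scale/= mulr1.
  move=> w wv; rewrite !ffunE eq_sym (negbTE wv).
  by rewrite /GRing.scale/= mulr0.
rewrite {1}uE mulr_sumr.
apply: (@le_trans _ _ (\sum_w `|u w| * nu (dl w))).
  elim/big_ind2 : _ => [|x1 y1 x2 y2 h1 h2|w _].
  - by rewrite is_norm0.
  - by case: Hnu => hD _ _; rewrite (le_trans (hD _ _))// lerD.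
  - by case: Hnu => _ -> _.
apply: ler_sum => w _; rewrite mulrC ler_wpM2r// (bigD1 w)//= lerDl.
by apply: sumr_ge0 => z _; exact: is_norm_ge0.
Qed.

(** The norm attains a positive minimum on the unit sphere of the sup norm. *)
Lemma is_norm_ge_coord : exists2 C, 0 <= C &
  forall (u : {ffun I -> R}) v, `|u v| <= C * nu u.
Proof.
pose phi (r : 'rV[R]_#|I|) : {ffun I -> R} := [ffun v => r 0 (enum_rank v)].
have phiB r r' : phi r - phi r' = phi (r - r').
  by apply/ffunP => v; rewrite !ffunE !mxE.
have phiZ a r : phi (a *: r) = a *: phi r.
  by apply/ffunP => v; rewrite !ffunE !mxE.
have coord (r : 'rV[R]_#|I|) i : `|r 0 i| <= `|r|.
  rewrite [leRHS]/Num.norm /= mx_normrE.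
  exact: (le_bigmax _ (fun ij : 'I_1 * 'I_#|I| => `|r ij.1 ij.2|) (0, i)).
have [C1 C10 hC1] := is_norm_le_l1.
pose K := C1 * #|I|%:R.
have K0 : 0 <= K by rewrite mulr_ge0.
have nuK r : nu (phi r) <= K * `|r|.
  apply: le_trans (hC1 _) _; rewrite -mulrA ler_wpM2l//.
  rewrite mulr_natl -sumr_const; apply: ler_sum => v _.
  by rewrite ffunE.
have cnu : continuous (nu \o phi).
  apply: (@norm_lip_continuous _ 'rV[R]_#|I| _ K) => // r r'.
  by apply: le_trans (is_norm_dist _ _) _; rewrite phiB.
pose S : set 'rV[R]_#|I| := [set r | `|r| = 1].
have [S0|S0] := pselect (S !=set0); last first.
  exists 0 => // u v; have [->|uv] := eqVneq (u v) 0.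
    by rewrite normr0 mul0r.
  case: S0; pose r : 'rV[R]_#|I| := \row_i u (enum_val i).
  exists (`|r|^-1 *: r); rewrite /S /= normrZ normfV normr_id mulVf//.
  rewrite normr_eq0; apply/eqP => r0.
  have := congr1 (fun r : 'rV__ => r 0 (enum_rank v)) r0.
  by rewrite !mxE enum_rankK => /eqP; rewrite (negbTE uv).
have cS : compact S.
  apply: bounded_closed_compact.
    by exists 1; split => // x x1 r /= ->; exact: ltW.
  have -> : S = (fun r : 'rV[R]_#|I| => `|r|) @^-1` [set 1] by [].
  by apply: closed_comp => [r _|]; [exact: norm_continuous|exact: closed_eq].
have [r0 /set_mem r0S r0min] := compact_EVT_min S0 cS
  (@continuous_subspaceT _ _ _ _ cnu).
have nur0 : 0 < nu (phi r0).
  rewrite lt_neqAle is_norm_ge0 andbT; apply/eqP => /esym nu0.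
  case: Hnu => _ _ /(_ _ nu0) phi0.
  have : r0 = 0.
    apply/rowP => i; have := congr1 (fun f : {ffun I -> R} => f (enum_val i)) phi0.
    by rewrite !ffunE enum_valK mxE.
  move=> r00; have : `|r0| = 1 by [].
  by rewrite r00 normr0 => /esym/eqP; rewrite oner_eq0.
exists (nu (phi r0))^-1 => [|u v]; first by rewrite invr_ge0 ltW.
pose r : 'rV[R]_#|I| := \row_i u (enum_val i).
have ur : u = phi r by apply/ffunP => w; rewrite !ffunE mxE enum_rankK.
have ule : `|u v| <= `|r| by rewrite ur ffunE.
apply: le_trans ule _; rewrite ler_pdivlMl//.
have [->|rn0] := eqVneq r 0; first by rewrite normr0 mulr0 is_norm_ge0.
have rS : S (`|r|^-1 *: r).
  by rewrite /S /= normrZ normfV normr_id mulVf// normr_eq0.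
have := r0min _ (mem_set rS); rewrite /= phiZ -ur.
case: Hnu => _ -> _; rewrite normfV normr_id => h.
by rewrite mulrC -ler_pdivlMl// normr_gt0.
Qed.

End FiniteDimensionalNorm.

Section Simplex.
Variables (R : realType) (X : pmetricType R) (P : metricComplex R).
Variables (F : X -> P) (C : R).
Hypothesis Flip : is_lipschitz C F.

(** A simplex with [N+1] vertices needs only [N] of its barycentric
    coordinates, as they sum to 1. *)
Lemma simplex_coordinates (N : nat) (s : {fset vertex (complex_of P)}) :
  simplex s -> (#|` s| <= N.+1)%N ->
  exists2 b : 'I_N -> X -> R, (forall j, lipb (b j)) &
    exists2 L, 0 <= L & forall x y,
      closed_simplex s (bary (F x)) -> closed_simplex s (bary (F y)) ->
      mdist (F x) (F y) <= L * \sum_(j < N) `|b j x - b j y|.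
Proof.
move=> ss sN; have [nu Hnu nuE] := metric_norm ss.
have [C1 C10 hC1] := is_norm_le_l1 Hnu.
have [C2 C20 hC2] := is_norm_ge_coord Hnu.
pose E x := closed_simplex s (bary (F x)).
case es : (enum_fset s) => [|v0 e].
  case: (@simplex_neq0 (complex_of P)).
  suff -> : fset0 = s by [].
  by apply/fsetP => v; rewrite in_fset0 -[RHS]/(v \in enum_fset s) es.
have se v : (v \in s) = (v \in v0 :: e) by rewrite -es.
have eN : (size e <= N)%N.
  by move: sN; rewrite -[size _]/(size (enum_fset s)) es.
(* for [j >= size e] the default value [v0] gives one more Lipschitz function,
   which can only increase the right-hand side *)
pose w (j : 'I_N) := nth v0 e j.
have ws j : w j \in s.
  rewrite se inE /w; case: (ltnP j (size e)) => h.
    by rewrite mem_nth ?orbT.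
  by rewrite nth_default// eqxx.
have Ele1 x v : E x -> v \in s -> `|bary (F x) v| <= 1.
  move=> [b0 _ b1] vs; rewrite ger0_norm// -b1 (big_rem v)//= lerDl.
  by rewrite sumr_ge0.
have Ediff x y v : E x -> E y -> v \in s ->
    `|bary (F x) v - bary (F y) v| <= C2 * mdist (F x) (F y).
  move=> Ex Ey vs; rewrite (nuE _ _ Ex Ey).
  by have := hC2 [ffun v : s => bary (F x) (val v) - bary (F y) (val v)] [` vs]%fset;
    rewrite ffunE.
have ext j : exists2 h, lipb h & forall x, E x -> h x = bary (F x) (w j).
  apply: (@lipb_extension _ _ E (fun x => bary (F x) (w j)) 1 (C2 * `|C|)).
  - by rewrite mulr_ge0.
  - by move=> x Ex; exact: Ele1.
  - move=> x y Ex Ey; apply: le_trans (Ediff _ _ _ Ex Ey (ws j)) _.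
    rewrite -mulrA ler_wpM2l// (le_trans (Flip x y))//.
    by rewrite ler_wpM2r ?mdist_ge0// ler_norm.
pose b j := s2val (cid2 (ext j)).
have lb j : lipb (b j) := s2valP (cid2 (ext j)).
have bE j : forall x, E x -> b j x = bary (F x) (w j) := s2valP' (cid2 (ext j)).
exists b => //; exists (C1 * 2) => [|x y Ex Ey]; first by rewrite mulr_ge0.
rewrite (nuE _ _ Ex Ey); apply: le_trans (hC1 _) _.
rewrite -mulrA ler_wpM2l//.
pose d v := bary (F x) v - bary (F y) v.
have -> : \sum_(v : s) `|[ffun v : s => bary (F x) (val v) - bary (F y) (val v)] v| =
    \sum_(v <- s) `|d v|.
  by rewrite big_seq_fsetE/=; apply: eq_bigr => v _; rewrite ffunE.
have d0 : \sum_(v <- s) d v = 0.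
  by rewrite sumrB; case: Ex => _ _ ->; case: Ey => _ _ ->; rewrite subrr.
move: d0; rewrite es !big_cons => /eqP.
(* the coordinates sum to 1 at both points, which bounds the difference at [v0]
   by the others; hence the factor 2 *)
rewrite addr_eq0 => /eqP ->; rewrite normrN.
apply: (@le_trans _ _ (2 * \sum_(v <- e) `|d v|)).
  by rewrite mulr_natl mulr2n lerD2r ler_norm_sum.
rewrite ler_wpM2l// (big_nth v0) big_mkord.
rewrite (big_ord_widen N (fun i => `|d (nth v0 e i)|))// big_mkcond.
apply: ler_sum => j _; case: ifP => _ //.
by rewrite !bE.
Qed.

End Simplex.

(** * Vanishing of the Jacobian determinants *)

Section Vanishing.
Variables (R : realType) (X : pmetricType R).
Variable mu : {measure set (borel X) -> \bar R}.
Hypothesis sf : compact_semifinite mu.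
Variables (n : nat) (D : 'I_n -> (X -> R) -> borel X -> R).
Hypothesis dD : forall i, is_derivation mu (D i).

(** The functions [f k] are replaced by limits of functions with a gradient that
    agree with them on [E]; locality brings the conclusion back to [f]. *)
Lemma det_jac_on_set (N : nat) (b : 'I_N -> X -> R) (E : set X)
    (f : 'I_n -> X -> R) :
  (N < n)%N -> (forall j, lipb (b j)) -> (forall k, lipb (f k)) ->
  (forall k, exists2 L, 0 <= L & forall x y, E x -> E y ->
    `|f k x - f k y| <= L * \sum_(j < N) `|b j x - b j y|) ->
  {ae mu, forall x : borel X, E x -> \det (jac D f x) = 0}.
Proof.
move=> Nn lb lf hf.
pose B := [set h : X -> R | lipb h /\
  exists2 fk : nat -> X -> R, (forall k, has_gradient mu D b (fk k)) &
      lipb_weak_cvg fk h].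
have ext k : exists2 h, B h & forall x, E x -> h x = f k x.
  have [L L0 hL] := hf k.
  have [h [lh hE] hB] := gradient_approximation lb sf dD (lf k) L0 hL.
  by exists h.
pose h k := s2val (cid2 (ext k)).
have hB k : B (h k) := s2valP (cid2 (ext k)).
have hE k : forall x, E x -> h k x = f k x := s2valP' (cid2 (ext k)).
have det0 : {ae mu, forall x, \det (jac D h x) = 0}.
  apply: (det_jac_closure sf dD (A := has_gradient mu D b) (B := B)) => //.
  - by move=> p [].
  - by move=> p [].
  - by move=> p [].
  - by move=> p hp; exact: (det_jac_gradient Nn hp).
have loc : {ae mu, forall x : borel X, forall i k,
    h k x = f k x -> D i (h k) x = D i (f k) x}.
  apply: ae_forall_fin => i; apply: ae_forall_fin => k.
  by apply: der_local => //; case: (hB k).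
apply: filterS2 det0 loc => x det0 loc Ex; rewrite -[RHS]det0.
by congr (\det _); apply/matrixP => i k; rewrite !mxE loc ?hE.
Qed.

(** The carrier of a point is the face spanned by the vertices where its
    barycentric coordinates are positive. *)
Lemma realization_carrier (K : simplicialComplex) (p : vertex K -> R) :
  realization R K p -> exists s : {fset vertex K},
    [/\ simplex s, closed_simplex s p & forall v, (v \in s) = (0 < p v)].
Proof.
case=> s ss [p0 ps p1].
pose t := [fset v in s | 0 < p v]%fset.
have tE v : (v \in t) = (0 < p v).
  rewrite !inE; case: (boolP (v \in s)) => vs //=.
  by rewrite ps// ltxx.
have pt v : v \notin t -> p v = 0.
  by rewrite tE -leNgt => h; apply/eqP; rewrite eq_le h p0.
have ts : (t `<=` s)%fset by apply/fsubsetP => v; rewrite !inE => /andP[].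
have t1 : \sum_(v <- t) p v = 1.
  by rewrite -p1; apply: big_fset_incl => // v _ /pt.
exists t; split => //; apply: (simplex_face ss ts).
by apply: contra_eq_neq t1 => ->; rewrite big_seq_fset0 eq_sym oner_neq0.
Qed.

Lemma negligible_bigcup_countable (T : choiceType) (S : set T)
    (A : T -> set (borel X)) : countable S ->
  (forall s, S s -> mu.-negligible (A s)) ->
  mu.-negligible (\bigcup_(s in S) A s).
Proof.
move=> /countable_injP[c cinj] hA.
pose G k := \bigcup_(s in S `&` [set s | c s = k]) A s.
have -> : \bigcup_(s in S) A s = \bigcup_k G k.
  apply/seteqP; split => x; first by move=> [s Ss As]; exists (c s) => //; exists s.
  by move=> [k _ [s [Ss _] As]]; exists s.
apply: negligible_bigcup => k.
have [[s [Ss sk]]|nk] := pselect (exists s, S s /\ c s = k).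
  apply: negligibleS (hA s Ss) => x [t [St tk] At].
  suff -> : s = t by [].
  by apply: cinj; rewrite ?inE// sk.
apply: negligibleS (negligible_set0 mu) => x [t [St tk] _].
by case: nk; exists t.
Qed.

(** If the determinant were nonzero on a set of positive measure, it would be so
    on a compact set of positive measure; its image is compact, hence meets
    countably many open simplices, and on the preimage of each closed simplex
    the barycentric coordinates apply. *)
Lemma det_jac_pullback (N : nat) (P : metricComplex R) (F : X -> P) (C : R)
    (f : 'I_n -> X -> R) :
  (N < n)%N -> is_dimension (complex_of P) N -> is_lipschitz C F ->
  (forall k, lipb (f k)) ->
  (forall k, exists2 L, 0 <= L & forall x y,
    `|f k x - f k y| <= L * mdist (F x) (F y)) ->
  {ae mu, forall x, \det (jac D f x) = 0}.
Proof.
move=> Nn [dimP _] Flip lf hf.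
pose B : set (borel X) := [set x | \det (jac D f x) != 0].
have mdet := Linfty_measurable (Linfty_jac_det dD lf).
have mB : measurable B.
  have -> : B = setT `&` (fun x => \det (jac D f x)) @^-1` (~` [set 0]).
    by rewrite setTI; apply/seteqP; split => x /= /eqP.
  by apply: mdet => //; exact: measurableC.
suff : ~ (0 < mu B)%E.
  move=> /negP; rewrite -leNgt measure_le0 => /eqP B0.
  by exists B; split => // x /= /eqP.
move=> /(sf mB)[K [cK KB mK /andP[K0 _]]].
pose E (s : {fset vertex (complex_of P)}) : set X :=
  [set x | closed_simplex s (bary (F x))].
pose S := [set s : {fset vertex (complex_of P)} | simplex s /\
  exists2 y, (F @` K) y & forall v, (v \in s) = (0 < bary y v)].
have cS : countable S.
  apply: metric_compat; apply: continuous_compact => //.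
  by apply: continuous_subspaceT; exact: lip_continuous Flip.
have KS : K `<=` \bigcup_(s in S) ((E s `&` B) : set (borel X)).
  move=> x Kx; have : realization R (complex_of P) (bary (F x)).
    by rewrite -bary_range; exists (F x).
  move=> /realization_carrier[s [ss sE sv]]; exists s.
    by split => //; exists (F x) => //; exists x.
  by split => //; exact: KB.
have : mu.-negligible K.
  apply: negligibleS KS _; apply: negligible_bigcup_countable => // s [ss _].
  have [b lb [L L0 hL]] := simplex_coordinates Flip ss (dimP _ ss).
  have : {ae mu, forall x : borel X, E s x -> \det (jac D f x) = 0}.
    apply: (det_jac_on_set Nn lb) => // k; have [L' L'0 hL'] := hf k.
    exists (L' * L) => [|x y Ex Ey]; first exact: mulr_ge0.
    by rewrite -mulrA (le_trans (hL' x y))// ler_wpM2l// hL.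
  by apply: negligibleS => x [Ex Bx] /= /(_ Ex) /eqP; apply/negP.
by move/(measure_negligible mK) => K00; rewrite K00 ltxx in K0.
Qed.

(** Iterated limits produce columns that live on different levels of the tower;
    [rho_mono] lets them all descend from the top one. *)
Lemma det_jac_TAP (N : nat) (f : 'I_n -> X -> R) : (N < n)%N -> TAP N X ->
  (forall k, lipb (f k)) -> {ae mu, forall x, \det (jac D f x) = 0}.
Proof.
move=> Nn [C [Cn [s [P [F [[_ s0] dimP Flip Fs Fmono]]]]]].
pose rho m x y := mdist (F m x) (F m y).
have rhoP m : is_pseudodist (rho m).
  exact: pseudodist_comp (mdist_pseudodist _).
have rhoC m x y : rho m x y <= `|C| * mdist x y.
  rewrite (le_trans (Flip m x y))//.
  by rewrite ler_wpM2r ?mdist_ge0// ler_norm.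
have rho_mono m m' : (m <= m')%N ->
    exists2 L, 0 <= L & forall x y, rho m x y <= L * rho m' x y.
  elim: m' => [|m' IH].
    by rewrite leqn0 => /eqP ->; exists 1 => // x y; rewrite mul1r.
  rewrite leq_eqVlt => /orP[/eqP ->|]; first by exists 1 => // x y; rewrite mul1r.
  rewrite ltnS => /IH[L L0 hL]; exists (L * `|Cn m'|); first exact: mulr_ge0.
  move=> x y; rewrite (le_trans (hL x y))// -mulrA ler_wpM2l//.
  rewrite (le_trans (Fmono m' x y))// ler_wpM2r ?mdist_ge0// ler_norm.
  by [].
pose A m := [set g : X -> R | lipb g /\
  exists2 L, 0 <= L & forall x y, `|g x - g y| <= L * rho m x y].
apply: (det_jac_closure sf dD (A := \bigcup_m A m) (B := @lipb R X)) => //.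
- by move=> g [m _ []].
- move=> g lg; have /lipbP[[M hM] [L L0 hL]] := lg.
  have X0 : [set: X] !=set0 by exists point.
  have gM x : setT x -> - M <= g x.
    by move=> _; have := hM x; rewrite ler_norml => /andP[].
  pose gk m := infconv (rho m) setT g L.
  have gkle m x : gk m x <= g x.
    have := infconv_le X0 (rhoP m) L0 gM x (x := x) I.
    by case: (rhoP m) => -> _ _; rewrite mulr0 addr0.
  have gkge m x : g x - `|L * C| * `|s m| <= gk m x.
    apply: infconv_ge => // y _.
    have h1 : L * (mdist y x - C * s m) <= L * rho m y x.
      rewrite ler_wpM2l//; have := Fs m y x; rewrite ler_norml => /andP[+ _].
      by rewrite -/(rho m y x); lra.
    have h2 : L * C * s m <= `|L * C| * `|s m| by rewrite -normrM ler_norm.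
    have := hL x y; rewrite metric_sym ler_norml => /andP[_ h3].
    move: h1 h2 h3; rewrite mulrBr mulrA; lra.
  have gklip m x y : `|gk m x - gk m y| <= L * rho m x y.
    exact: (infconv_lip X0 (rhoP m) L0 gM).
  have gkd m x y : `|gk m x - gk m y| <= (L * `|C|) * mdist x y.
    by rewrite (le_trans (gklip m x y))// -mulrA ler_wpM2l.
  exists gk => [m|]; first exists m => //; first split.
  + apply/lipbP; split; last by exists (L * `|C|); [exact: mulr_ge0|].
    exists M => x; rewrite ler_norml (infconv_ge_lb X0 (rhoP m) L0 gM)/=.
    by rewrite (le_trans (gkle m x))// (le_trans (ler_norm _)).
  + by exists L.
  split.
    by exists (L * `|C|) => m; apply: lip_const_le; [exact: mulr_ge0|].
  move=> x; apply: (@squeeze_cvgr _ _ _ _ (fun m => g x - `|L * C| * `|s m|)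
      (fun _ => g x)).
  + by near=> m; rewrite gkge gkle.
  + rewrite -[X in _ --> X]subr0; apply: cvgB; first exact: cvg_cst.
    rewrite -[X in _ --> X](mulr0 `|L * C|); apply: cvgM; first exact: cvg_cst.
    by rewrite -[X in _ --> X](normr0 R); apply: cvg_norm.
  + exact: cvg_cst.
- move=> g gA.
  pose m k := s2val (cid2 (gA k)).
  have gm k : A (m k) (g k) := s2valP' (cid2 (gA k)).
  pose M := (\max_k m k)%N.
  apply: (det_jac_pullback Nn (dimP M) (Flip M)) => k; first by case: (gm k).
  have [_ [L L0 hL]] := gm k.
  have [L' L'0 hL'] := rho_mono (m k) M (leq_bigmax k).
  exists (L * L') => [|x y]; first exact: mulr_ge0.
  by rewrite (le_trans (hL x y))// -mulrA ler_wpM2l// hL'.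
Unshelve. all: by end_near. Qed.

End Vanishing.

(** * Compact sets and Radon measures *)

Section Radon.
Variables (R : realType) (X : pmetricType R).
Variable mu : {measure set (borel X) -> \bar R}.
Hypothesis rmu : is_radon mu.

Lemma radon_compact_finite (K : set (borel X)) : compact (K : set X) ->
  measurable K -> (mu K < +oo)%E.
Proof.
move=> cK mK; have [lf _] := rmu.
pose U x := sval (cid (lf x)).
have hU x : [/\ open (U x), U x x & (mu (U x) < +oo)%E] := svalP (cid (lf x)).
have : cover_compact (K : set X) by rewrite -compact_cover.
move=> /(_ X setT U) [x _|x _|D _ KD]; first by case: (hU x).
  by exists x => //; case: (hU x).
have mU x : measurable (U x : set (borel X)).
  by apply: borel_open; case: (hU x).
have fin (r : seq X) : measurable (\big[setU/set0]_(x <- r) U x : set (borel X)) /\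
    (mu (\big[setU/set0]_(x <- r) U x) < +oo)%E.
  elim: r => [|x r [mr IH]]; first by rewrite big_nil measure0.
  rewrite big_cons; split; first exact: measurableU.
  apply: le_lt_trans (measureU2 _ _ _) _ => //.
  by rewrite lte_add_pinfty//; case: (hU x).
have [mr] := fin (enum_fset D); apply: le_lt_trans; apply: le_measure;
  rewrite ?inE//.
by apply: subset_trans KD _; rewrite /cover bigcup_fset.
Qed.

Lemma radon_compact_semifinite (U : set (borel X)) (mU : measurable U) :
  compact_semifinite (mrestr mu mU).
Proof.
move=> B mB BU.
have mBU : measurable (B `&` U) by exact: measurableI.
have : (0 < mu (B `&` U))%E by exact: BU.
rewrite (rmu.2 _ mBU) => /ereal_sup_gt[_ [K [cK KBU] <-]] K0.
have mK : measurable (K : set (borel X)).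
  by apply: borel_closed; apply: compact_closed => //; exact: metric_hausdorff.
exists K; split => //; first by move=> x /KBU[].
change (0 < mu (K `&` U) < +oo)%E; rewrite setIidl; last by move=> x /KBU[].
by rewrite K0 radon_compact_finite.
Qed.

End Radon.

(** * Minors of independent derivations *)

Section Independence.
Variables (R : realType) (X : pmetricType R).
Variable mu : {measure set (borel X) -> \bar R}.

(** If the minor of [f] did not extend to a nonzero minor one size larger, then
    expanding the larger minors along their last column would give a linear
    relation whose last coefficient is the minor of [f]. *)
Lemma lin_indep_minor (n : nat) (D : 'I_n -> (X -> R) -> borel X -> R) :
  (forall i, is_derivation mu (D i)) -> (0 < mu setT)%E -> lin_indep mu D ->
  forall r (rn : (r <= n)%N), exists2 f : 'I_r -> X -> R,
    (forall k, lipb (f k)) &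
    ~ {ae mu, forall x, \det (jac (fun i => D (widen_ord rn i)) f x) = 0}.
Proof.
move=> dD muT indep; elim=> [|r IH] rn.
  exists (fun _ => cst 0) => [k|h]; first exact: lipb_cst.
  have : {ae mu, forall x : borel X, False}.
    by apply: filterS h => x /eqP; rewrite det_mx00 oner_eq0.
  rewrite /almost_everywhere /= => /negligibleP; rewrite setC0 => /(_ measurableT).
  by move=> h0; rewrite h0 ltxx in muT.
have [f lf fdet] := IH (ltnW rn); apply: contrapT => nex.
pose fg (g : X -> R) (k : 'I_r.+1) := if unlift ord_max k is Some j then f j else g.
have fg_max g : fg g ord_max = g by rewrite /fg unlift_none.
have lfg g k : lipb g -> lipb (fg g k).
  by move=> lg; rewrite /fg; case: unlift.
pose D' (i : 'I_r.+1) := D (widen_ord rn i).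
have det0 g : lipb g -> {ae mu, forall x, \det (jac D' (fg g) x) = 0}.
  move=> lg; apply: contrapT => h; apply: nex; exists (fg g) => // k.
  exact: lfg.
(* the cofactors along the last column do not depend on the last function, so
   it may be taken to be 0 in them *)
pose lam' (i : 'I_r.+1) x := cofactor (jac D' (fg (cst 0)) x) i ord_max.
pose lam (i : 'I_n) : borel X -> R :=
  if (i < r.+1)%N then lam' (inord i) else cst 0.
have lamL i : Linfty mu (lam i).
  rewrite /lam; case: ifP => _; last exact: Linfty_cst.
  apply: Linfty_jac_cofactor => [k|k]; first exact: dD.
  by apply: lfg; exact: lipb_cst.
have := indep lam lamL _ (widen_ord rn ord_max) => /(_ _)/wrap[g lg|].
  apply: filterS (det0 g lg) => x dx; rewrite -[RHS]dx (expand_det_col _ ord_max).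
  rewrite (bigID (fun i : 'I_n => (i < r.+1)%N))/= [X in _ + X]big1 ?addr0.
    rewrite (big_ord_narrow rn); apply: eq_bigr => i _.
    rewrite mxE fg_max mulrC /lam /= ltn_ord; congr (_ * _).
    have -> : inord (widen_ord rn i) = i by apply: val_inj; rewrite /= inordK.
    apply: jac_cofactor => k; rewrite /fg; case: unliftP => [j _ //|->].
    by rewrite eqxx.
  by move=> i /negbTE ir; rewrite /lam ir mul0r.
move=> hlam; apply: fdet; apply: filterS hlam => x; rewrite /lam /= ltnSn /lam' => h.
have e : inord r = ord_max :> 'I_r.+1 by apply: val_inj; rewrite /= inordK.
move: h; rewrite e /cofactor addnn -signr_odd odd_double expr0 mul1r => h.
rewrite -[RHS]h; congr (\det _); apply/matrixP => i j; rewrite !mxE /fg liftK.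
by congr (D _ _ _); apply: val_inj; rewrite /= /bump leqNgt ltn_ord.
Qed.

End Independence.

Theorem theorem2p79 (R : realType) (N : nat) (X : pmetricType R)
    (mu : {measure set (borel X) -> \bar R}) :
  TAP N X -> is_radon mu -> (analytic_dimension mu <= (N%:R : R)%:E)%E.
Proof.
move=> tap rmu; apply: ub_ereal_sup => _ [n [->|[U [mU [muU [D [dD indep]]]]]] <-].
  by rewrite lee_fin.
rewrite lee_fin ler_nat leqNgt; apply/negP => Nn.
have nuT : (0 < mrestr mu mU setT)%E by rewrite /mrestr setTI.
(* the first [N+1] derivations have a nonzero Jacobian determinant *)
have [f lf] := lin_indep_minor dD nuT indep Nn; apply.
apply: det_jac_TAP tap lf => //; exact: radon_compact_semifinite.
Qed.
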